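(* Let $n>1$ be a positive integer. The following decision problem is undecidable: given an $\epsilon$-free labeled P/T net $G$ and a partition $\{R_1,\dots,R_n\}$ of the set of its reachable markings, decide whether $G$ is weakly approximately detectable with respect to $\{R_1,\dots,R_n\}$.
   Context: A net is $N=(P,T,Pre,Post)$ with $P$ a finite set of places, $T$ a finite set of transitions, $P\cup T\neq\emptyset$, $P\cap T=\emptyset$, and $Pre,Post:P\times T\to\mathbb{N}$. A marking is a map $M:P\to\mathbb{N}$. A transition $t$ is enabled at $M$ if $M(p)\ge Pre(p,t)$ for all $p\in P$; firing it yields $M'$ with $M'(p)=M(p)-Pre(p,t)+Post(p,t)$, written $M[t\rangle M'$. This extends to finite sequences $s\in T^*$ ($M[s\rangle M'$, with $M[\epsilon\rangle M$, $\epsilon$ the empty word) and to infinite sequences $s\in T^\omega$ (enabled if all finite prefixes are). A labeled P/T net (labeled Petri net) is $G=(N,M_0,\Sigma,\ell)$, where $M_0$ is an initial marking, $\Sigma$ a finite alphabet and $\ell:T\to\Sigma\cup\{\epsilon\}$ a labeling function, extended to finite and infinite sequences by concatenation. $G$ is $\epsilon$-free if $\ell(T)\subset\Sigma$. The set of reachable markings is $\mathcal{R}(N,M_0)=\{M\in\mathbb{N}^P\mid \exists s\in T^*: M_0[s\rangle M\}$. For $\sigma\in\Sigma^*$, $\mathcal{M}(G,\sigma)=\{M\in\mathbb{N}^P\mid \exists s\in T^*: M_0[s\rangle M,\ \ell(s)=\sigma\}$. The $\omega$-language $\mathcal{L}^\omega(G)$ is the set of all $\sigma\in\Sigma^\omega$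 such that $\sigma=\ell(t_1t_2\dots)$ for some infinite transition sequence $t_1t_2\dots\in T^\omega$ enabled at $M_0$. $G$ is weakly approximately detectable with respect to a partition $\{R_1,\dots,R_n\}$ of $\mathcal{R}(N,M_0)$ if there exist $\sigma\in\mathcal{L}^\omega(G)$ and a positive integer $k$ such that for every (finite) prefix $\sigma'$ of $\sigma$ with $|\sigma'|\ge k$ one has $\emptyset\neq\mathcal{M}(G,\sigma')\subset R_{i}$ for some $i=i_{\sigma'}\in\{1,\dots,n\}$. As input to the decision problem, the partition is given by a finite description, e.g. each cell $R_i$ is the intersection of $\mathcal{R}(N,M_0)$ with a set of markings described by a finite Boolean combination of conditions $M(p)=c$ ($p\in P$, $c\in\mathbb{N}$). *)

(* Defs.v *)
From mathcomp Require Import all_boot.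
From mathcomp Require Import boolp classical_sets.
Set Implicit Arguments.
Unset Strict Implicit.
Unset Printing Implicit Defensive.

Local Open Scope classical_set_scope.

Definition marking (P : finType) := {ffun P -> nat}.

(* Places and transitions live in distinct types, hence are disjoint. *)
Record net (P T : finType) := Net {
  Pre : {ffun P * T -> nat};
  Post : {ffun P * T -> nat};
  net_nonempty : (0 < #|P| + #|T|)%N
}.

Definition enabled (P T : finType) (N : net P T) (M : marking P) (t : T) : bool :=
  [forall p, Pre N (p, t) <= M p]%N.

(* The subtraction is truncated, but it is only used when [enabled N M t]. *)
Definition fire (P T : finType) (N : net P T) (M : marking P) (t : T) : marking P :=
  [ffun p => M p - Pre N (p, t) + Post N (p, t)]%N.

Fixpoint firing (P T : finType) (N : net P T) (M : marking P) (s : seq T)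
    (M' : marking P) : Prop :=
  if s is t :: s' then enabled N M t /\ firing N (fire N M t) s' M' else M' = M.

Definition omega_enabled (P T : finType) (N : net P T) (M : marking P)
    (tau : nat -> T) : Prop :=
  forall k, exists M', firing N M (mkseq tau k) M'.

(* The label [None] stands for the empty word. *)
Record lpn (P T Sigma : finType) := LPN {
  lpn_net :> net P T;
  M0 : marking P;
  lab : {ffun T -> option Sigma}
}.

Definition eps_free (P T Sigma : finType) (G : lpn P T Sigma) : Prop :=
  forall t, lab G t != None.

Definition lab_word (P T Sigma : finType) (G : lpn P T Sigma) (s : seq T) : seq Sigma :=
  pmap (lab G) s.

(* [sigma] is the infinite word obtained by concatenating the labels of [tau];
   the second condition rules out the case where this concatenation is finite. *)
Definition lab_omega (P T Sigma : finType) (G : lpn P T Sigma) (tau : nat -> T)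
    (sigma : nat -> Sigma) : Prop :=
  (forall m, lab_word G (mkseq tau m) = mkseq sigma (size (lab_word G (mkseq tau m))))
  /\ (forall k, exists m, (k <= size (lab_word G (mkseq tau m)))%N).

Definition reachable (P T Sigma : finType) (G : lpn P T Sigma) : set (marking P) :=
  [set M | exists s, firing G (M0 G) s M].

Definition consistent (P T Sigma : finType) (G : lpn P T Sigma) (w : seq Sigma) :
    set (marking P) :=
  [set M | exists s, firing G (M0 G) s M /\ lab_word G s = w].

Definition omega_language (P T Sigma : finType) (G : lpn P T Sigma) :
    set (nat -> Sigma) :=
  [set sigma | exists tau, omega_enabled G (M0 G) tau /\ lab_omega G tau sigma].

Definition weakly_approx_detectable (P T Sigma : finType) (G : lpn P T Sigma)
    (n : nat) (R : 'I_n -> set (marking P)) : Prop :=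
  exists2 sigma, omega_language G sigma &
    exists2 k, (0 < k)%N &
      forall j, (k <= j)%N ->
        consistent G (mkseq sigma j) !=set0 /\
        exists i, consistent G (mkseq sigma j) `<=` R i.

(* Boolean combinations of the conditions [M(p) = c]. *)
Inductive cond (P : Type) :=
  | Atom of P & nat
  | Not of cond P
  | And of cond P & cond P
  | Or of cond P & cond P.

Fixpoint sat (P : finType) (M : marking P) (f : cond P) : bool :=
  match f with
  | Atom p c => M p == c
  | Not f1 => ~~ sat M f1
  | And f1 f2 => sat M f1 && sat M f2
  | Or f1 f2 => sat M f1 || sat M f2
  end.

Fixpoint tree_of_cond (P : Type) (f : cond P) : GenTree.tree (P * nat) :=
  match f with
  | Atom p c => GenTree.Leaf (p, c)
  | Not f1 => GenTree.Node 0 [:: tree_of_cond f1]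
  | And f1 f2 => GenTree.Node 1 [:: tree_of_cond f1; tree_of_cond f2]
  | Or f1 f2 => GenTree.Node 2 [:: tree_of_cond f1; tree_of_cond f2]
  end.

Fixpoint cond_of_tree (P : Type) (t : GenTree.tree (P * nat)) : option (cond P) :=
  match t with
  | GenTree.Leaf (p, c) => Some (Atom p c)
  | GenTree.Node 0 [:: t1] => omap (@Not P) (cond_of_tree t1)
  | GenTree.Node 1 [:: t1; t2] =>
      if cond_of_tree t1 is Some f1 then omap (And f1) (cond_of_tree t2) else None
  | GenTree.Node 2 [:: t1; t2] =>
      if cond_of_tree t1 is Some f1 then omap (Or f1) (cond_of_tree t2) else None
  | _ => None
  end.

Lemma tree_of_condK (P : Type) : pcancel (@tree_of_cond P) (@cond_of_tree P).
Proof. by elim=> [p c|f /= ->|f /= -> g ->|f /= -> g ->]. Qed.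

Record instance (n : nat) := Instance {
  np : nat;
  nt : nat;
  ns : nat;
  inet : lpn 'I_np 'I_nt 'I_ns;
  icond : {ffun 'I_n -> cond 'I_np}
}.

Definition cells (n : nat) (x : instance n) (i : 'I_n) : set (marking 'I_(np x)) :=
  reachable (inet x) `&` [set M | sat M (icond x i)].

Arguments cells {n} x i.

(* [partition] requires the cells to be nonempty and pairwise disjoint. *)
Definition admissible (n : nat) (x : instance n) : Prop :=
  eps_free (inet x) /\ partition setT (cells x) (reachable (inet x)).

(* Numerical code of a finite function, through the list of its values. *)
Definition code_ffun (A : finType) (B : countType) (f : {ffun A -> B}) : nat :=
  CodeSeq.code [seq pickle (f a) | a <- enum A].

Definition code_instance (n : nat) (x : instance n) : nat :=
  CodeSeq.code [:: code_ffun (M0 (inet x)); np x; nt x; ns x;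
    code_ffun (Pre (inet x)); code_ffun (Post (inet x)); code_ffun (lab (inet x));
    code_ffun [ffun i => tree_of_cond (icond x i)]].

Lemma code_ffun_inj (A : finType) (B : countType) : injective (@code_ffun A B).
Proof.
move=> f g /(can_inj CodeSeq.codeK) /eq_in_map fg.
by apply/ffunP => a; apply/(pcan_inj pickleK)/fg; rewrite mem_enum.
Qed.

Lemma code_instance_inj (n : nat) : injective (@code_instance n).
Proof.
move=> [p t s [[pre post ne] m l] c] [p' t' s' [[pre' post' ne'] m' l'] c'].
move=> /(can_inj CodeSeq.codeK) /= [Em Ep Et Es]; subst p' t' s'.
move: Em => /code_ffun_inj Em /code_ffun_inj Epre /code_ffun_inj Epost.
move=> /code_ffun_inj El /code_ffun_inj /ffunP Ec; subst pre' post' m' l'.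
suff -> : c = c' by rewrite (bool_irrelevance ne ne').
by apply/ffunP => i; have := Ec i; rewrite !ffunE => /(pcan_inj (@tree_of_condK _)).
Qed.

(* [Dec r q] decrements register [r] and proceeds to the next instruction if [r]
   is nonzero, and jumps to instruction [q] otherwise. *)
Inductive instr :=
  | Inc of nat
  | Dec of nat & nat.

Definition config := (nat * (nat -> nat))%type.

Definition write (v : nat -> nat) (r x : nat) : nat -> nat :=
  fun r' => if r' == r then x else v r'.

(* The machine halts, and its configuration no longer changes, as soon as the
   program counter points outside of the program. *)
Definition step (prog : seq instr) (c : config) : config :=
  let: (pc, v) := c in
  match onth prog pc with
  | Some (Inc r) => (pc.+1, write v r (v r).+1)
  | Some (Dec r q) =>
      if v r == 0%N then (q, v) else (pc.+1, write v r (v r).-1)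
  | None => c
  end.

(* Started at instruction 0 with [x] in register 0 and all other registers empty,
   [prog] eventually halts with [y] in register 0. *)
Definition computes (prog : seq instr) (x y : nat) : Prop :=
  exists k, let c := iter k (step prog) (0%N, write (fun=> 0%N) 0 x) in
    (size prog <= c.1)%N /\ c.2 0%N = y.

(* The decider only has to be correct on the codes of the objects in [dom]. *)
Definition decides (X : Type) (code : X -> nat) (dom Q : X -> Prop)
    (prog : seq instr) : Prop :=
  forall x, dom x ->
    (Q x -> computes prog (code x) 1) /\ (~ Q x -> computes prog (code x) 0).

Definition undecidable (X : Type) (code : X -> nat) (dom Q : X -> Prop) : Prop :=
  ~ exists prog, decides code dom Q prog.

(* Main.v *)
(* Diagonalization. Suppose a register machine D decides the problem. A machine
   E that computes the code of an instance x from two parameters, runs D on it,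
   and halts iff D accepts, is simulated by the net of x, whose initial marking
   contains these two parameters. The code of x has the shape
   2 ^ c (2 b + 1), c = 2 ^ a (2 (2 ^ b (2 a + 1)) + 1), where b encodes everything
   but the initial marking and a encodes the initial marking outside of the two
   parameters, so that the parameters can be taken to be a and b themselves.

   The net guesses the outcome of zero tests, and the labels show the guess. A
   wrong guess can be punished: with the same labels, the net may enter states
   that wander freely between the cells and follow any label, so that the cell
   is never known again. Hence only the honest run can witness detectability,
   and the net is detectable iff E runs forever, that is iff D rejects x. *)

Require Import Defs.
From mathcomp Require Import all_boot zify.
From mathcomp Require Import boolp classical_sets.
Set Implicit Arguments.
Unset Strict Implicit.
Unset Printing Implicit Defensive.

(** * Register machines with explicit successor addresses *)

Inductive ginstr :=
  | GInc of nat & nat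
  | GDec of nat & nat & nat.

Definition delta (o : option nat) (r : nat) : nat := (o == Some r).

Definition upd (dec inc : option nat) (v : nat -> nat) : nat -> nat :=
  fun r => v r - delta dec r + delta inc r.

Definition gstep (E : seq ginstr) (c : config) : config :=
  match onth E c.1 with
  | Some (GInc r q) => (q, upd None (Some r) c.2)
  | Some (GDec r q1 q0) =>
      if c.2 r == 0 then (q0, c.2) else (q1, upd (Some r) None c.2)
  | None => c
  end.

Definition runs_forever (E : seq ginstr) (x : config) : Prop :=
  forall k, (iter k (gstep E) x).1 < size E.

Definition runs (E : seq ginstr) (x y : config) : Prop :=
  exists k, iter k (gstep E) x = y.

Lemma runs_refl E x : runs E x x.
Proof. by exists 0. Qed.

Lemma runs_trans E x y z : runs E x y -> runs E y z -> runs E x z.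
Proof. by move=> [k <-] [l <-]; exists (l + k); rewrite iterD. Qed.

Lemma runs_step E x y : runs E (gstep E x) y -> runs E x y.
Proof. by move=> [k <-]; exists k.+1; rewrite iterSr. Qed.

Lemma upd_inc r v : upd None (Some r) v = write v r (v r).+1.
Proof.
apply/funext => r'; rewrite /upd /write /delta /= subn0.
have -> : (Some r == Some r') = (r' == r) by rewrite eq_sym.
by case: eqP => [->|_]; rewrite ?addn1 ?addn0.
Qed.

Lemma upd_dec r v : upd (Some r) None v = write v r (v r).-1.
Proof.
apply/funext => r'; rewrite /upd /write /delta /= addn0.
have -> : (Some r == Some r') = (r' == r) by rewrite eq_sym.
by case: eqP => [->|_]; rewrite ?subn1 ?subn0.
Qed.

Lemma runs_exit E x y : runs E x y -> size E <= y.1 -> ~ runs_forever E x.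
Proof. by move=> [k <-] + /(_ k) => /leq_gtF ->. Qed.

(** If the run had left the program at time [j], it would be frozen there; at time [j + k] it would
    be both there and at [y], which lies inside. *)
Lemma runs_loop E x y : runs E x y -> gstep E y = y -> y.1 < size E ->
  runs_forever E x.
Proof.
move=> [k kE] yE y_lt j; rewrite ltnNge; apply/negP => j_ge.
have fixj l : iter l (gstep E) (iter j (gstep E) x) = iter j (gstep E) x.
  by elim: l => //= l ->; rewrite {1}/gstep onth_default.
have fixy l : iter l (gstep E) y = y by elim: l => //= l ->.
have yj : y = iter j (gstep E) x.
  by rewrite -(fixj k) -(fixy j) -kE -!iterD addnC.
by rewrite yj ltnNge j_ge in y_lt.
Qed.

(** * Loop programs and their compilation *)

Inductive prog :=
  | PInc of nat
  | PSeq of prog & prog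
  | PLoop of nat & prog.

Fixpoint exec (p : prog) (v : nat -> nat) : nat -> nat :=
  match p with
  | PInc r => write v r (v r).+1
  | PSeq p q => exec q (exec p v)
  | PLoop r p => iter (v r) (fun u => exec p (write u r (u r).-1)) v
  end.

Fixpoint writes (p : prog) : seq nat :=
  match p with
  | PInc r => [:: r]
  | PSeq p q => writes p ++ writes q
  | PLoop r p => r :: writes p
  end.

(* In well-formed programs a loop runs as many times as the initial value of
   its register. *)
Fixpoint wf (p : prog) : bool :=
  match p with
  | PInc r => true
  | PSeq p q => wf p && wf q
  | PLoop r p => (r \notin writes p) && wf p
  end.

(* Code of [p] placed at address [o], continuing at address [k]. *)
Fixpoint comp (p : prog) (o k : nat) : seq ginstr :=
  match p with
  | PInc r => [:: GInc r k]
  | PSeq p q =>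
      let c := comp p o (o + size (comp p 0 0)) in
      c ++ comp q (o + size (comp p 0 0)) k
  | PLoop r p => GDec r o.+1 k :: comp p o.+1 o
  end.

(** Addresses do not affect lengths, so [comp p 0 0] measures a block before its exit address is
    known. *)
Lemma size_comp p o k : size (comp p o k) = size (comp p 0 0).
Proof.
elim: p o k => //= [p IHp q IHq|r p IHp] o k; last by rewrite IHp (IHp 1).
by rewrite !size_cat !(IHp _ (_ + _)) (IHq _ k) [in RHS]IHq.
Qed.

Lemma exec_writes p v r : r \notin writes p -> exec p v r = v r.
Proof.
elim: p v => /= [r'|p IHp q IHq|r' p IHp] v.
- by rewrite inE /write => /negPf ->.
- by rewrite mem_cat negb_or => /andP[rp rq]; rewrite IHq // IHp.
rewrite inE negb_or => /andP[/negPf rr' rp].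
by elim: (v r') => //= k IHk; rewrite IHp // /write rr'.
Qed.

Lemma comp_correct p E1 E2 k v : wf p ->
  runs (E1 ++ comp p (size E1) k ++ E2) (size E1, v) (k, exec p v).
Proof.
elim: p E1 E2 k v => /= [r|p IHp q IHq|r p IHp] E1 E2 k v.
- move=> _; apply: runs_step; rewrite /gstep /= onth_cat ltnn subnn /= upd_inc.
  exact: runs_refl.
- move=> /andP[wp wq]; set c := comp p _ _.
  rewrite -catA; apply: runs_trans (IHp E1 _ _ v wp) _.
  rewrite catA; have := size_comp p (size E1) (size E1 + size (comp p 0 0)).
  rewrite -/c; clearbody c => <-; rewrite -size_cat; exact: IHq.
move=> /andP[rp wp].
set E := E1 ++ _; set o := size E1.
have head w : gstep E (o, w) =
    if w r == 0 then (k, w) else (o.+1, write w r (w r).-1).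
  by rewrite /gstep /= onth_cat ltnn subnn /= upd_dec.
have EE : E = rcons E1 (GDec r o.+1 k) ++ comp p o.+1 o ++ E2 by rewrite cat_rcons.
(* Induction on the loop register, which the body leaves unchanged by well-formedness. *)
have [m mE] : {m | v r = m} by exists (v r).
rewrite mE; elim: m v mE => [|m IHm] v mE.
  by apply: runs_step; rewrite head mE; apply: runs_refl.
apply: runs_step; rewrite head iterSr mE /=.
apply: (@runs_trans _ _ (o, exec p (write v r m))).
  by have := IHp (rcons E1 (GDec r o.+1 k)) E2 o (write v r m) wp;
    rewrite /= size_rcons -EE.
apply: IHm.
by rewrite exec_writes // /write eqxx.
Qed.

(** * A loop program that computes the code of the diagonal instance *)

Definition regs (s : seq nat) : nat -> nat := nth 0 s.

Lemma write_regs s r x : write (regs s) r x = regs (set_nth 0 s r x).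
Proof. by apply/funext => r'; rewrite /regs nth_set_nth. Qed.

Notation "p ;; q" := (PSeq p q) (at level 60, right associativity).

(** Register 5 is scratch: empty before and after. *)
Definition pdouble (r : nat) : prog :=
  PLoop r (PInc 5 ;; PInc 5) ;; PLoop 5 (PInc r).

Definition pshift (r e : nat) : prog := PLoop e (pdouble r).

(** Registers 3 and 4 keep copies of [a] and [b]; register 2 goes from 2a + 1 to the code of the
    marking, by which 2b + 1 in register 0 is finally shifted. *)
Definition self_code : prog :=
  (PInc 2 ;; PLoop 0 (PInc 2 ;; PInc 2 ;; PInc 3)) ;;
  (PInc 0 ;; PLoop 1 (PInc 0 ;; PInc 0 ;; PInc 4)) ;;
  pshift 2 4 ;; pdouble 2 ;; PInc 2 ;; pshift 2 3 ;; pshift 0 2.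

(** This is [CodeSeq.code] of a list with head [a] and tail of code [c]. *)
Definition code_head (a c : nat) : nat := 2 ^ a * c.*2.+1.

Lemma exec_seq p q v : exec (p ;; q) v = exec q (exec p v).
Proof. by []. Qed.

(** Loop invariant: [F k] is the state when [k] passes remain. *)
Lemma exec_loop r p (F : nat -> nat -> nat) v n :
    v r = n -> v = F n ->
    (forall k, k < n -> exec p (write (F k.+1) r (F k.+1 r).-1) = F k) ->
  exec (PLoop r p) v = F 0.
Proof.
move=> /= -> ->; elim: n => // n IHn FE.
by rewrite iterSr FE // IHn // => k /ltnW; apply: FE.
Qed.

Lemma exec_double2 x0 x1 x2 x3 x4 :
  exec (pdouble 2) (regs [:: x0; x1; x2; x3; x4; 0]) =
  regs [:: x0; x1; x2.*2; x3; x4; 0].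
Proof.
rewrite exec_seq.
rewrite (@exec_loop 2 _ (fun k => regs [:: x0; x1; k; x3; x4; (x2 - k).*2]) _ x2) //.
- rewrite (@exec_loop _ _ (fun k => regs [:: x0; x1; x2.*2 - k; x3; x4; k]) _ x2.*2) //.
  + by rewrite subn0.
  + by rewrite /regs /= subn0.
  + by rewrite subn0 subnn.
  + by move=> k lt_k; rewrite /= !write_regs /= -subSn.
- by rewrite subnn.
by move=> k lt_k; rewrite /= !write_regs /= -!doubleS -subSn.
Qed.

Lemma exec_double0 x0 x1 x2 x3 x4 :
  exec (pdouble 0) (regs [:: x0; x1; x2; x3; x4; 0]) =
  regs [:: x0.*2; x1; x2; x3; x4; 0].
Proof.
rewrite exec_seq.
rewrite (@exec_loop 0 _ (fun k => regs [:: k; x1; x2; x3; x4; (x0 - k).*2]) _ x0) //.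
- rewrite (@exec_loop _ _ (fun k => regs [:: x0.*2 - k; x1; x2; x3; x4; k]) _ x0.*2) //.
  + by rewrite subn0.
  + by rewrite /regs /= subn0.
  + by rewrite subn0 subnn.
  + by move=> k lt_k; rewrite /= !write_regs /= -subSn.
- by rewrite subnn.
by move=> k lt_k; rewrite /= !write_regs /= -!doubleS -subSn.
Qed.

Definition self_value (a b : nat) : nat :=
  code_head (code_head a (code_head b a)) b.

Lemma doubleX x n k : k < n -> (2 ^ (n - k.+1) * x).*2 = 2 ^ (n - k) * x.
Proof. by move=> lt_k; rewrite -mul2n mulnA -expnS -subSn. Qed.

Lemma exec_load0 a b :
  exec (PInc 2 ;; PLoop 0 (PInc 2 ;; PInc 2 ;; PInc 3)) (regs [:: a; b]) =
  regs [:: 0; b; a.*2.+1; a].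
Proof.
rewrite exec_seq [exec (PInc 2) _]write_regs.
rewrite (@exec_loop _ _ (fun k => regs [:: k; b; (a - k).*2.+1; a - k]) _ a) //.
- by rewrite subn0.
(* The lists differ by a trailing zero, the default value in [regs]. *)
- by rewrite subnn; apply/funext; do 5?case.
by move=> k lt_k; rewrite /= !write_regs /= -!doubleS -subSn.
Qed.

Lemma exec_load1 b x2 x3 :
  exec (PInc 0 ;; PLoop 1 (PInc 0 ;; PInc 0 ;; PInc 4)) (regs [:: 0; b; x2; x3]) =
  regs [:: b.*2.+1; 0; x2; x3; b; 0].
Proof.
rewrite exec_seq [exec (PInc 0) _]write_regs.
rewrite (@exec_loop _ _ (fun k => regs [:: (b - k).*2.+1; k; x2; x3; b - k; 0]) _ b) //.
- by rewrite subn0.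
- by rewrite subnn; apply/funext; do 7?case.
by move=> k lt_k; rewrite /= !write_regs /= -!doubleS -subSn.
Qed.

Lemma exec_shift24 x0 x1 x2 x3 b :
  exec (pshift 2 4) (regs [:: x0; x1; x2; x3; b; 0]) =
  regs [:: x0; x1; 2 ^ b * x2; x3; 0; 0].
Proof.
rewrite (@exec_loop _ _ (fun k => regs [:: x0; x1; 2 ^ (b - k) * x2; x3; k; 0]) _ b) //.
- by rewrite subn0.
- by rewrite subnn mul1n.
by move=> k lt_k; rewrite write_regs exec_double2 doubleX.
Qed.

Lemma exec_shift23 x0 x1 x2 a x4 :
  exec (pshift 2 3) (regs [:: x0; x1; x2; a; x4; 0]) =
  regs [:: x0; x1; 2 ^ a * x2; 0; x4; 0].
Proof.
rewrite (@exec_loop _ _ (fun k => regs [:: x0; x1; 2 ^ (a - k) * x2; k; x4; 0]) _ a) //.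
- by rewrite subn0.
- by rewrite subnn mul1n.
by move=> k lt_k; rewrite write_regs exec_double2 doubleX.
Qed.

Lemma exec_shift02 x0 x1 c x3 x4 :
  exec (pshift 0 2) (regs [:: x0; x1; c; x3; x4; 0]) =
  regs [:: 2 ^ c * x0; x1; 0; x3; x4; 0].
Proof.
rewrite (@exec_loop _ _ (fun k => regs [:: 2 ^ (c - k) * x0; x1; k; x3; x4; 0]) _ c) //.
- by rewrite subn0.
- by rewrite subnn mul1n.
by move=> k lt_k; rewrite write_regs exec_double0 doubleX.
Qed.

Lemma exec_self_code a b :
  exec self_code (regs [:: a; b]) = write (fun=> 0) 0 (self_value a b).
Proof.
have -> : write (fun=> 0) 0 (self_value a b) =
    regs [:: self_value a b; 0; 0; 0; 0; 0] by apply/funext; do 7?case.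
rewrite /self_code exec_seq exec_load0 exec_seq exec_load1.
rewrite exec_seq exec_shift24 exec_seq exec_double2 exec_seq.
rewrite [exec (PInc 2) _]write_regs exec_seq exec_shift23 exec_shift02.
by rewrite /self_value /code_head.
Qed.

(** * The diagonal machine *)

Definition conv (s i : nat) (d : instr) : ginstr :=
  match d with
  | Inc r => GInc r i.+1
  | Dec r q => GDec r i.+1 (minn q s)
  end.

(* Entered at [entry D], this runs [D] on the result of [self_code], then loops
   forever if the result is 0 and exits otherwise. Placing [D] at address 0 saves
   relocating its jumps. *)
Definition diag (D : seq instr) : seq ginstr :=
  let s := size D in
  [seq conv s i (nth (Inc 0) D i) | i <- iota 0 s] ++
  GDec 0 (s.+1 + size (comp self_code s.+1 0)) s :: comp self_code s.+1 0.

Definition entry (D : seq instr) : nat := (size D).+1.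

Lemma size_diag D : size (diag D) = (size D).+1 + size (comp self_code (size D).+1 0).
Proof. by rewrite size_cat size_map size_iota /= addnS. Qed.

Lemma gstep_diag D x : x.1 < size D ->
  gstep (diag D) x = (minn (step D x).1 (size D), (step D x).2).
Proof.
case: x => pc v /= pc_lt.
rewrite /gstep /diag /= onth_cat size_map size_iota pc_lt.
rewrite (onth_map _ _ _) onthE (nth_map 0) ?size_iota // nth_iota //=.
rewrite onthE (nth_map (Inc 0)) //.
case: (nth _ _ _) => [r|r q] /=; first by rewrite upd_inc (minn_idPl _).
by case: eqP => _ //=; rewrite upd_dec (minn_idPl _).
Qed.

(** All halting addresses of [D] are merged into [size D], where the exit test sits. Once [D] has
    halted, its steps are matched by no step at all. *)
Lemma diag_simulates D x k :
  let y := iter k (step D) x in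
  runs (diag D) (minn x.1 (size D), x.2) (minn y.1 (size D), y.2).
Proof.
elim: k x => [|k IHk] x /=; first exact: runs_refl.
rewrite -iterS iterSr; have [x_lt|x_ge] := ltnP x.1 (size D).
  by rewrite -surjective_pairing; apply: runs_step; rewrite gstep_diag.
suff -> : step D x = x by have := IHk x; rewrite /= (minn_idPr x_ge).
by case: x x_ge => pc v /= x_ge; rewrite onth_default.
Qed.

Lemma diag_self_code D v :
  runs (diag D) (entry D, v) (0, exec self_code v).
Proof.
rewrite /diag -cat_rcons; set E1 := rcons _ _.
have sE1 : size E1 = entry D by rewrite size_rcons size_map size_iota.
have := @comp_correct self_code E1 [::] 0 v isT.
by rewrite cats0 sE1.
Qed.

Lemma gstep_diag_exit D v :
  gstep (diag D) (size D, v) =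
  if v 0 == 0 then (size D, v) else (size (diag D), upd (Some 0) None v).
Proof. by rewrite size_diag /gstep /= onth_cat size_map size_iota ltnn subnn. Qed.

(** The run reaches the exit test with [y] in register 0; zero repeats the test forever, any other
    value leaves the program. *)
Lemma diag_computes D a b y :
  computes D (self_value a b) y ->
  runs_forever (diag D) (entry D, regs [:: a; b]) <-> y = 0.
Proof.
move=> [k [kD ky]].
have [v v0 run] : exists2 v, v 0 = y &
    runs (diag D) (entry D, regs [:: a; b]) (size D, v).
  eexists; first exact: ky.
  apply: runs_trans (diag_self_code D _) _; rewrite exec_self_code.
  have := diag_simulates D (0, write (fun=> 0) 0 (self_value a b)) k.
  by rewrite /= min0n (minn_idPr kD).
split=> [forever|y0].
  apply/eqP; rewrite -v0; apply: contraTT isT => v_neq0; exfalso.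
  apply: (runs_exit (runs_trans run (runs_step (runs_refl _ _)))) forever.
  by rewrite gstep_diag_exit (negPf v_neq0).
apply: runs_loop run _ _; first by rewrite gstep_diag_exit v0 y0.
by rewrite size_diag ltnS leq_addr.
Qed.

(** * Labeled rules with guessed zero tests *)

Definition greg (g : ginstr) : nat :=
  match g with GInc r _ => r | GDec r _ _ => r end.

(* Label, source and register to decrement, target and register to increment. *)
Definition rule := ('I_2 * (nat * option nat) * (nat * option nat))%type.

Definition fires (rl : rule) (x : config) : bool :=
  let: (_, (c, dec), _) := rl in
  (c == x.1) && (if dec is Some r then 0 < x.2 r else true).

Definition act (rl : rule) (x : config) : config :=
  let: (_, (_, dec), (c, inc)) := rl in (c, upd dec inc x.2).

(* The control states [0], ..., [n - 1] represent the cells of the partition;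
   address [i] of the machine is represented by the control state [n + i].
   Label [ord_max] announces a jump of [GDec]; if the jump is dishonest, the same
   label also leads to all the states [j < n]. At [GInc] it only leads to these
   states, which makes every cell reachable if the machine starts with [GInc]. *)
Definition instr_rules (n i : nat) (g : ginstr) : seq rule :=
  match g with
  | GInc r q =>
      (ord0, (n + i, None), (n + q, Some r)) ::
      [seq (ord_max, (n + i, None), (j, None)) | j <- iota 0 n]
  | GDec r q1 q0 =>
      [:: (ord0, (n + i, Some r), (n + q1, None)),
          (ord_max, (n + i, None), (n + q0, None)) &
          [seq (ord_max, (n + i, Some r), (j, None)) | j <- iota 0 n]]
  end.

Definition rules (n : nat) (E : seq ginstr) : seq rule :=
  flatten [seq oapp (instr_rules n i) [::] (onth E i) | i <- iota 0 (size E)] ++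
  flatten [seq [seq (l, (j, None), (k, None)) | j <- iota 0 n, k <- iota 0 n]
          | l <- enum 'I_2].

Definition lstep n E (x : config) (l : 'I_2) (y : config) : Prop :=
  exists2 rl, rl \in rules n E & [/\ rl.1.1 = l, fires rl x & y = act rl x].

Lemma mem_rules n E rl : rl \in rules n E <->
  (exists i g, onth E i = Some g /\ rl \in instr_rules n i g) \/
  (exists l j k, [/\ j < n, k < n & rl = (l, (j, None), (k, None))]).
Proof.
rewrite mem_cat; split.
  case/orP=> [/flatten_mapP[i _]|/flatten_mapP[l _ /allpairsP[[j k]]]] /=.
    by case Ei: (onth E i) => [g|] //= rl_g; left; exists i, g.
  by rewrite !mem_iota /= => -[jn kn ->]; right; exists l, j, k.
case=> [[i [g [Ei rl_g]]]|[l [j [k [jn kn ->]]]]]; apply/orP.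
  left; apply/flatten_mapP; exists i; last by rewrite Ei.
  by rewrite mem_iota /= -onthTE Ei.
right; apply/flatten_mapP; exists l; first by rewrite mem_enum.
by apply/allpairsP; exists (j, k); rewrite !mem_iota.
Qed.

Lemma mem_instr_rules n i g rl : rl \in instr_rules n i g <->
  match g with
  | GInc r q =>
      rl = (ord0, (n + i, None), (n + q, Some r)) \/
      exists2 j, j < n & rl = (ord_max, (n + i, None), (j, None))
  | GDec r q1 q0 =>
      [\/ rl = (ord0, (n + i, Some r), (n + q1, None)),
          rl = (ord_max, (n + i, None), (n + q0, None)) |
          exists2 j, j < n & rl = (ord_max, (n + i, Some r), (j, None))]
  end.
Proof.
case: g => [r q|r q1 q0]; rewrite !inE.
  split=> [/orP[/eqP->|/mapP[j]]|[->|[j jn ->]]]; rewrite ?eqxx //.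
  - by left.
  - by rewrite mem_iota => /= jn ->; right; exists j.
  by apply/orP; right; apply/mapP; exists j; rewrite // mem_iota.
split=> [/or3P[/eqP->|/eqP->|/mapP[j]]|[->|->|[j jn ->]]]; rewrite ?eqxx ?orbT //.
- exact: Or31.
- exact: Or32.
- by rewrite mem_iota => /= jn ->; apply: Or33; exists j.
by apply/or3P/Or33/mapP; exists j; rewrite // mem_iota.
Qed.

Definition emb (n : nat) (x : config) : config := (n + x.1, x.2).

Definition honest (E : seq ginstr) (x : config) : 'I_2 :=
  if onth E x.1 is Some (GDec r _ _) then
    if x.2 r == 0 then ord_max else ord0
  else ord0.

Lemma upd_none v : upd None None v = v.
Proof. by apply/funext => r; rewrite /upd /delta /= subn0 addn0. Qed.

Lemma lstep_honest n E x : x.1 < size E ->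
  lstep n E (emb n x) (honest E x) (emb n (gstep E x)).
Proof.
case: x => pc v /= pc_lt; rewrite /honest /gstep /=.
have: onth E pc by rewrite onthTE.
case Epc: (onth E pc) => [[r q|r q1 q0]|] //= _.
- exists (ord0, (n + pc, None), (n + q, Some r)); last by split; rewrite /= ?eqxx.
  by apply/mem_rules; left; do 2!eexists; split; [exact: Epc|apply/mem_instr_rules; left].
case: ifPn => vr.
  exists (ord_max, (n + pc, None), (n + q0, None)).
    apply/mem_rules; left; do 2!eexists; split; first exact: Epc.
    by apply/mem_instr_rules; apply: Or32.
  by split; rewrite /= ?eqxx ?upd_none.
exists (ord0, (n + pc, Some r), (n + q1, None)).
  apply/mem_rules; left; do 2!eexists; split; first exact: Epc.
  by apply/mem_instr_rules; apply: Or31.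
by split; rewrite /= ?eqxx ?lt0n.
Qed.

(** At a [GDec] with empty register only the jump fires. With nonempty register [ord_max] is
    dishonest, and the punishing rules, which decrement that register, are enabled. *)
Lemma lstep_emb n E x l y : lstep n E (emb n x) l y ->
  [/\ x.1 < size E, l = honest E x -> y = emb n (gstep E x) &
      l <> honest E x -> forall j, j < n -> exists v, lstep n E (emb n x) l (j, v)].
Proof.
case: x => pc v [rl /mem_rules[]]; last first.
  (* Rules between cell states start below [n], embedded addresses do not. *)
  by move=> [l' [j [k [jn kn ->]]]] [_ /= /andP[/eqP jE] _]; lia.
move=> [i [g [Ei /[dup] rl_in]]].
have lt_i : i < size E by rewrite -onthTE Ei.
have mem rl' : rl' \in instr_rules n i g -> rl' \in rules n E.
  by move=> ?; apply/mem_rules; left; exists i, g.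
case: g Ei rl_in mem => [r q|r q1 q0] Ei _ mem /mem_instr_rules.
  case=> [->|[j jn ->]] [<- /= /andP[/eqP/addnI<- _] ->].
    by rewrite /honest /gstep /= Ei.
  rewrite /honest /gstep /= Ei; split=> // _ k kn; eexists.
  exists (ord_max, (n + i, None), (k, None)); last by split; rewrite //= eqxx.
  by apply/mem/mem_instr_rules; right; exists k.
case=> [->|->|[j jn ->]] [<- /= /andP[/eqP/addnI<-]] => [vr|_|vr] ->.
- by rewrite /honest /gstep /= Ei gtn_eqF.
- rewrite /honest /gstep /= Ei; case: ifPn => vr.
    by split; rewrite // upd_none.
  split=> // _ k kn; eexists.
  exists (ord_max, (n + i, Some r), (k, None)); last by split; rewrite //= eqxx lt0n.
  by apply/mem/mem_instr_rules; apply: Or33; exists k.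
rewrite /honest /gstep /= Ei gtn_eqF //; split=> // _ k kn; eexists.
exists (ord_max, (n + i, Some r), (k, None)); last by split; rewrite //= eqxx.
by apply/mem/mem_instr_rules; apply: Or33; exists k.
Qed.

Lemma lstep_cell n E j k l v : j < n -> k < n ->
  lstep n E (j, v) l (k, v).
Proof.
move=> jn kn; exists (l, (j, None), (k, None)); last first.
  by split; rewrite //= ?eqxx ?upd_none.
by apply/mem_rules; right; exists l, j, k.
Qed.

Fixpoint trace n E (x : config) (w : seq 'I_2) (y : config) : Prop :=
  if w is l :: w' then exists2 z, lstep n E x l z & trace n E z w' y else y = x.

Lemma trace_rcons n E x w l y : trace n E x (rcons w l) y <->
  exists2 z, trace n E x w z & lstep n E z l y.
Proof.
elim: w x => [|l' w IHw] x /=.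
  split=> [[z xz ->]|[z ->]]; first by exists x.
  by exists y.
split=> [[z xz /IHw[u zu uy]]|[u [z xz zu] uy]].
  by exists u => //; exists z.
by exists z => //; apply/IHw; exists u.
Qed.

(** * The net of the rules *)

Section Net.
Variables (n R : nat) (E : seq ginstr).
Hypothesis E_regs : forall i g, onth E i = Some g -> greg g < R.+2.

(** There are [R.+2] registers, so that every marking begins with the two parameters. *)
Definition nplaces : nat := (R + (n + (n + size E))).+2.

(** Machine addresses count as cell 0, so the honest run never changes cell. *)
Definition cell_of (c : nat) : nat := if c < n then c else 0.

(* Places below [R.+2] are the registers, the next [n] places tell the cell,
   and the other ones the control state. *)
Definition mark (c : nat) (v : nat -> nat) (p : nat) : nat :=
  if p < R.+2 then v p
  else if p < R.+2 + n then cell_of c == p - R.+2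
  else c == p - (R.+2 + n).

Definition mk (x : config) : marking 'I_nplaces :=
  [ffun p : 'I_nplaces => mark x.1 x.2 p].

Definition rule_of (t : 'I_(size (rules n E))) : rule := tnth (in_tuple (rules n E)) t.

Lemma net_of_nonempty : 0 < #|'I_nplaces| + #|'I_(size (rules n E))|.
Proof. by rewrite card_ord. Qed.

(** A rule consumes the tokens of its source state and one from the register to decrement, and
    produces those of its target likewise; both sides have the form of [mark]. *)
Definition net_of : net 'I_nplaces 'I_(size (rules n E)) :=
  Net
    [ffun pt : 'I_nplaces * 'I_(size (rules n E)) =>
      mark (rule_of pt.2).1.2.1 (delta (rule_of pt.2).1.2.2) pt.1]
    [ffun pt : 'I_nplaces * 'I_(size (rules n E)) =>
      mark (rule_of pt.2).2.1 (delta (rule_of pt.2).2.2) pt.1]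
    net_of_nonempty.

Definition lpn_of (x : config) : lpn 'I_nplaces 'I_(size (rules n E)) 'I_2 :=
  LPN net_of (mk x) [ffun t => Some (rule_of t).1.1].

Definition instance_of (x : config) : instance n :=
  @Instance n _ _ _ (lpn_of x) [ffun i : 'I_n => Atom (inord (R.+2 + i)) 1].

Lemma rule_of_mem t : rule_of t \in rules n E.
Proof. exact: mem_tnth. Qed.

Lemma mem_rule_of rl : rl \in rules n E -> exists t, rule_of t = rl.
Proof. by move=> /(tnthP (in_tuple _))[t ->]; exists t. Qed.

(** So the control place of a source exists and enabledness tests it. A target outside the program
    marks no control place, and the net is stuck there. *)
Lemma rule_src rl : rl \in rules n E -> rl.1.2.1 < n + size E.
Proof.
case/mem_rules=> [[i [g [Ei /mem_instr_rules]]]|[l [j [k [jn _ ->]]]]]; last first.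
  exact: ltn_addr.
have lt_i : n + i < n + size E by rewrite ltn_add2l -onthTE Ei.
by case: g {Ei} => [r q [|[j _]] ->|r q1 q0 [||[j _]] ->].
Qed.

Lemma rule_dec rl r : rl \in rules n E -> rl.1.2.2 = Some r -> r < R.+2.
Proof.
case/mem_rules=> [[i [g [/E_regs Er /mem_instr_rules]]]|[l [j [k [jn _ ->]]]]] //.
by case: g Er => [r' q Er [|[j _]] ->|r' q1 q0 Er [||[j _]] ->] //= [<-].
Qed.

Lemma mark_cell c v i : i < n -> mark c v (R.+2 + i) = (cell_of c == i).
Proof. by move=> i_lt; rewrite /mark ltnNge leq_addr ltn_add2l i_lt addKn. Qed.

Lemma mark_ctl c v d : mark c v (R.+2 + n + d) = (c == d).
Proof.
have ge_R : R.+2 <= R.+2 + n + d by rewrite -addnA leq_addr.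
by rewrite /mark ltnNge ge_R ltnNge leq_addr addKn.
Qed.

(** The control place forces the control state, which determines the cell place; what remains is the
    test of the decremented register. *)
Lemma enabled_mk t x : enabled net_of (mk x) t = fires (rule_of t) x.
Proof.
have := @rule_dec _ _ (rule_of_mem t); have := rule_src (rule_of_mem t).
rewrite /enabled; case tE: (rule_of t) => [[l [c dec]] [c' inc]].
move=> /= c_lt dec_lt; apply/forallP/andP => [le_pre|[/eqP cE vdec] p]; last first.
  rewrite !ffunE /= tE /= cE /mark; case: ifP => // _; rewrite /delta.
  by case: eqP => // dE; rewrite dE in vdec.
split.
  have p_lt : R.+2 + n + c < nplaces by rewrite /nplaces; lia.
  have := le_pre (Ordinal p_lt); rewrite !ffunE tE !mark_ctl /= eqxx eq_sym.
  by case: eqP.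
case: dec tE dec_lt => // r tE /(_ r erefl) r_lt.
have p_lt : r < nplaces by apply: leq_trans r_lt _; rewrite /nplaces; lia.
by have := le_pre (Ordinal p_lt); rewrite !ffunE /= tE /= /mark r_lt /delta eqxx.
Qed.

Lemma fire_mk t x : fires (rule_of t) x -> fire net_of (mk x) t = mk (act (rule_of t) x).
Proof.
move: (erefl (rule_of t)); case: {2 3 4}(rule_of t) => [[l [c dec]] [c' inc]] tE /=.
case/andP=> /eqP cE _; apply/ffunP => p; rewrite !ffunE /= tE /= cE /mark.
by case: ifP => // _; rewrite subnn.
Qed.

Lemma firing_trace x0 x s M : firing net_of (mk x) s M ->
  exists2 y, trace n E x (lab_word (lpn_of x0) s) y & M = mk y.
Proof.
elim: s x => [|t s IHs] x /=; first by move=> ->; exists x.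
rewrite enabled_mk => -[tx]; rewrite fire_mk // => /IHs[y ty ->].
exists y => //; rewrite /lab_word /= ffunE /=; exists (act (rule_of t) x) => //.
by exists (rule_of t) => //; apply: rule_of_mem.
Qed.

Lemma trace_firing x0 x w y : trace n E x w y ->
  exists2 s, firing net_of (mk x) s (mk y) & lab_word (lpn_of x0) s = w.
Proof.
elim: w x => [|l w IHw] x /=; first by move=> ->; exists [::].
move=> [z [rl /mem_rule_of[t <-]] [<- tx ->] /IHw[s fs <-]].
exists (t :: s); first by rewrite /= enabled_mk fire_mk.
by rewrite /lab_word /= ffunE.
Qed.

Lemma consistentP x w M : consistent (lpn_of x) w M <->
  exists2 y, trace n E x w y & M = mk y.
Proof.
split=> [[s [/(firing_trace x) tr <-]]//|[y /(trace_firing x)[s fs sw] ->]].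
by exists s.
Qed.

Lemma reachable_mk x M : reachable (lpn_of x) M -> exists y, M = mk y.
Proof. by move=> [s /(firing_trace x)[y _ ->]]; exists y. Qed.

(** * The partition, admissibility and detectability *)

Lemma cell_of_lt c : 0 < n -> cell_of c < n.
Proof. by rewrite /cell_of; case: ifP. Qed.

Lemma sat_mk x0 y (i : 'I_n) :
  sat (mk y) (icond (instance_of x0) i) = (cell_of y.1 == i).
Proof.
have i_lt : R.+2 + i < nplaces by have := ltn_ord i; rewrite /nplaces; lia.
by rewrite /= ffunE /= ffunE inordK // mark_cell // eqb1.
Qed.

Lemma cellsP x0 y (i : 'I_n) : reachable (lpn_of x0) (mk y) ->
  cells (instance_of x0) i (mk y) <-> cell_of y.1 = i.
Proof.
move=> my; split=> [[_ yi]|yi]; first by apply/eqP; rewrite -(sat_mk x0).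
by split=> //; apply/(etrans (sat_mk x0 y i))/eqP.
Qed.

Lemma consistent_reachable x w M : consistent (lpn_of x) w M -> reachable (lpn_of x) M.
Proof. by move=> [s [fs _]]; exists s. Qed.

(** Exactly one cell place is marked, hence covering and disjointness. Cells are nonempty because
    [ord_max] leads from an increment to every cell state. *)
Lemma admissible_instance_of x r q : 0 < n -> onth E x.1 = Some (GInc r q) ->
  admissible (instance_of (emb n x)).
Proof.
move=> n_gt0 Ex; split; first by move=> t; rewrite ffunE.
split.
- apply/seteqP; split=> [M [i _ [rM _]] //|M rM].
  have [y My] := reachable_mk rM; rewrite My in rM *.
  by exists (Ordinal (cell_of_lt y.1 n_gt0)) => //; apply/cellsP.
- move=> i j _ _ [M [[rM Mi] Mj]]; have [y My] := reachable_mk rM.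
  have [rM' _] := Mj; rewrite My in rM rM' Mi Mj.
  apply: val_inj => /=; rewrite -((cellsP i rM).1 (conj rM Mi)).
  exact/(cellsP j rM).
move=> i _.
have [v xv] : exists v, lstep n E (emb n x) ord_max (i : nat, v).
  eexists; exists (ord_max, (n + x.1, None), (i : nat, None)).
    apply/mem_rules; left; exists x.1; eexists; split; first exact: Ex.
    by apply/mem_instr_rules; right; exists i.
  by split; rewrite //= eqxx.
have cM : consistent (lpn_of (emb n x)) [:: ord_max] (mk (i : nat, v)).
  by apply/consistentP; exists (i : nat, v) => //; exists (i : nat, v).
exists (mk (i : nat, v)); apply/cellsP; first exact: consistent_reachable cM.
by rewrite /cell_of ltn_ord.
Qed.

(** The word of honest labels is a witness: each of its prefixes has a single consistent marking,
    and it lies in cell 0. *)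
Lemma forever_detectable x : 0 < n -> runs_forever E x ->
  weakly_approx_detectable (lpn_of (emb n x)) (cells (instance_of (emb n x))).
Proof.
move=> n_gt0 forever.
pose X j := iter j (gstep E) x; pose sigma j := honest E (X j).
have stepX j : lstep n E (emb n (X j)) (sigma j) (emb n (X j.+1)).
  exact/lstep_honest/forever.
have traceX j : trace n E (emb n x) (mkseq sigma j) (emb n (X j)).
  elim: j => // j IHj; rewrite mkseqS; apply/trace_rcons.
  by exists (emb n (X j)).
have uniqX j y : trace n E (emb n x) (mkseq sigma j) y -> y = emb n (X j).
  elim: j y => [|j IHj] y //; rewrite mkseqS => /trace_rcons[z /IHj-> /lstep_emb].
  by case=> _ /(_ erefl).
have consX j : consistent (lpn_of (emb n x)) (mkseq sigma j) (mk (emb n (X j))).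
  by apply/consistentP; exists (emb n (X j)).
exists sigma; last first.
  exists 1 => // j _; split; first by exists (mk (emb n (X j))).
  exists (Ordinal n_gt0) => M cM; move: (cM) => /consistentP[y /uniqX yE ME].
  rewrite {M}ME {y}yE in cM *; apply/cellsP; first exact: consistent_reachable cM.
  by rewrite /cell_of /= ltnNge leq_addr.
have /choice[tau tauP] : forall j, exists t, [/\ (rule_of t).1.1 = sigma j,
    fires (rule_of t) (emb n (X j)) & emb n (X j.+1) = act (rule_of t) (emb n (X j))].
  by move=> j; have [rl /mem_rule_of[t <-]] := stepX j; exists t.
have word m : lab_word (lpn_of (emb n x)) (mkseq tau m) = mkseq sigma m.
  rewrite /lab_word; elim: m => // m IHm.
  rewrite !mkseqS -!cats1 pmap_cat IHm /= ffunE /=.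
  by have [-> _ _] := tauP m.
exists tau; split; last first.
  by split=> m; [|exists m]; rewrite word size_mkseq.
move=> m; exists (mk (emb n (X m))) => /=.
suff firingX i s : firing net_of (mk (emb n (X i))) [seq tau j | j <- iota i s]
    (mk (emb n (X (i + s)))) by have := firingX 0 m.
elim: s i => [|s IHs] i /=; first by rewrite addn0.
have [_ fi actE] := tauP i.
by rewrite enabled_mk fire_mk // -actE -addSnnS.
Qed.

(** A word that may lead to a cell state leads to all cells at every later time. So the labels of a
    witness are all honest, and they force the run of the machine. *)
Lemma detectable_forever x : 1 < n ->
  weakly_approx_detectable (lpn_of (emb n x)) (cells (instance_of (emb n x))) ->
  runs_forever E x.
Proof.
move=> n_gt1 [sigma _ [k _ detect]].
pose tr j y := trace n E (emb n x) (mkseq sigma j) y.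
have trS j y : tr j.+1 y <-> exists2 z, tr j z & lstep n E z (sigma j) y.
  by rewrite /tr mkseqS; exact: trace_rcons.
have tr_ex j : exists y, tr j y.
  (* Consistency of the prefixes of length at least [k] passes down to the shorter ones. *)
  suff trd d i : k <= i + d -> exists y, tr i y by apply: (trd k); rewrite leq_addl.
  elim: d i => [|d IHd] i; rewrite ?addn0 => ki; last first.
    by rewrite -addSnnS in ki; have [y /trS[z ? _]] := IHd _ ki; exists z.
  by have [[M /consistentP[y ty _]] _] := detect i ki; exists y.
have tr_cell j c v : tr j (c, v) -> c < n -> False.
  move=> jc cn.
  have all_cells d i : i < n -> tr (d + j).+1 (i, v).
    elim: d i => [|d IHd] i i_lt; apply/trS; exists (c, v) => //;
      try exact: lstep_cell.
    exact: IHd.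
  (* This length is past both the threshold [k] and the time [j] of the cell state. *)
  have [_ [i sub]] := detect (k + j).+1 (leqW (leq_addr _ _)).
  have cell_i l : l < n -> l = i.
    move=> ln; have cl : consistent (lpn_of (emb n x)) (mkseq sigma (k + j).+1) (mk (l, v)).
      by apply/consistentP; exists (l, v) => //; apply: all_cells.
    have := (cellsP i (consistent_reachable cl)).1 (sub _ cl).
    by rewrite /cell_of /= ln.
  by have := cell_i 1 n_gt1; rewrite -(cell_i 0 (ltnW n_gt1)).
have tr_run j y : tr j y -> y = emb n (iter j (gstep E) x).
  elim: j y => [|j IHj] y; first by [].
  move=> /trS[z /[dup] tz /IHj zE zy]; rewrite zE in tz zy.
  have [_ yE cheat] := lstep_emb zy.
  case: (eqVneq (sigma j) (honest E (iter j (gstep E) x))) => [/yE//|/eqP/cheat].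
  move=> /(_ 0 (ltnW n_gt1))[v zv]; case: (tr_cell j.+1 0 v); last exact: ltnW.
  by apply/trS; exists (emb n (iter j (gstep E) x)).
(* A step is possible only from an address inside the program. *)
move=> j; have [y /trS[z /tr_run-> /lstep_emb[]//]] := tr_ex j.+1.
Qed.

(* [a] and [b] do not depend on the two parameters of the initial marking. *)
Lemma code_instance_of pc : 1 < n -> exists a b,
  code_instance (instance_of (emb n (pc, regs [:: a; b]))) = self_value a b.
Proof.
move=> n_gt1.
pose a := CodeSeq.code [seq mark (n + pc) (fun=> 0) p | p <- iota 2 (R + (n + (n + size E)))].
(* Everything but the initial marking is the same for all initial configurations, so any one serves
   to define [b]. *)
pose i0 := instance_of (0, regs [::]).
pose b := CodeSeq.code [:: np i0; nt i0; ns i0; code_ffun (Pre (inet i0));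
  code_ffun (Post (inet i0)); code_ffun (lab (inet i0));
  code_ffun [ffun i => tree_of_cond (icond i0 i)]].
have bE x : code_instance (instance_of x) = code_head (code_ffun (mk x)) b by [].
exists a, b; rewrite bE /self_value; congr code_head.
rewrite /code_ffun (eq_map (g := mark (n + pc) (regs [:: a; b]) \o val)); last first.
  by move=> p; rewrite ffunE.
rewrite map_comp val_enum_ord.
have aE : CodeSeq.code [seq mark (n + pc) (regs [:: a; b]) p
    | p <- iota 2 (R + (n + (n + size E)))] = a.
  congr CodeSeq.code; apply/eq_in_map => p.
  by rewrite mem_iota => /andP[p2 _]; rewrite /mark /regs; case: p p2 => [|[|[]]].
(* The marking is listed as [a], [b] and then a list of code [a]. *)
by rewrite -[X in code_head b X]aE.
Qed.

End Net.

(** * Contradiction from a presumed decider *)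

Theorem theorem1 (n : nat) (hn : (1 < n)%N) :
  undecidable (@code_instance n) (@admissible n)
    (fun x : instance n => weakly_approx_detectable (inet x) (cells x)).
Proof.
move=> [D decD].
pose E := diag D.
pose R := \max_(g <- E) greg g.
have E_regs i g : onth E i = Some g -> greg g < R.+2.
  rewrite ltnS => Ei; apply/leqW; rewrite /R.
  elim: (E) i Ei => [|g' E' IHE] [|i] //=; rewrite big_cons leq_max.
    by case=> ->; rewrite leqnn.
  by move=> /IHE->; rewrite orbT.
(* [self_code] begins with an increment, as admissibility requires. *)
have entryE : exists q, onth E (entry D) = Some (GInc 2 q).
  rewrite /E /diag -cat_rcons onth_cat size_rcons size_map size_iota ltnn subnn.
  by eexists.
have [a [b codeE]] := code_instance_of R E (entry D) hn.
pose x : config := (entry D, regs [:: a; b]).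
have adm : admissible (instance_of n R E (emb n x)).
  have [q Eq] := entryE.
  exact: (admissible_instance_of E_regs (ltnW hn) (Eq : onth E x.1 = _)).
have [dec1 dec0] := decD _ adm; rewrite codeE in dec1 dec0.
have [wad|nwad] := pselect (weakly_approx_detectable (lpn_of n R E (emb n x))
  (cells (instance_of n R E (emb n x)))).
  (* [D] answers 1, yet the machine runs forever, which forces the answer 0. *)
  by have /(diag_computes (dec1 wad)) := detectable_forever E_regs hn wad.
(* [D] answers 0, so the machine runs forever and the net is detectable after all. *)
apply: (nwad); apply: forever_detectable => //; first exact: ltnW.
exact/(diag_computes (dec0 nwad)).
Qed.
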